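(* Let $n \ge 1$, let $\Gamma \subseteq \mathfrak{S}_n$ be a nonempty subset, let $\mathfrak{s} : \mathfrak{S}_n \to \mathbb{R}$ be a function, and let $t \ge 0$ be an integer. Define $\mathfrak{n}_t : \mathfrak{S}_n \to \mathbb{Z}$ by \[ \mathfrak{n}_t(\pi) = \#\{(\gamma_1,\ldots,\gamma_t) \in \Gamma^t \mid \gamma_1 \cdots \gamma_t = \pi\}. \] If at least one of the functions $\mathfrak{n}_t$ and $\mathfrak{s}$ is a class function (i.e. constant on conjugacy classes of $\mathfrak{S}_n$), then \[ \mathbb{E}_\Gamma(\mathfrak{s}, t) = \frac{n!}{|\Gamma|^t}\,\langle \overline{\mathfrak{s}}, \overline{\mathfrak{n}_t}\rangle . \]
   Context: $\mathfrak{S}_n$ is the symmetric group on $[n]=\{1,\ldots,n\}$. For a partition $\lambda \vdash n$, $C_\lambda$ denotes the conjugacy class of permutations of cycle type $\lambda$. Class functions are identified with functions $P_n \to \mathbb{C}$, where $P_n$ is the set of partitions of $n$, and the inner product on class functions is $\langle f, g\rangle = \frac{1}{n!}\sum_{\lambda \vdash n} |C_\lambda| f(\lambda)\overline{g(\lambda)}$. For any function $\mathfrak{s}:\mathfrak{S}_n \to \mathbb{R}$, the mean statistic $\overline{\mathfrak{s}}$ is the class function $\overline{\mathfrak{s}}(\lambda) = \frac{1}{|C_\lambda|}\sum_{\pi \in C_\lambda}\mathfrak{s}(\pi)$. $\mathbb{E}_\Gamma(\mathfrak{s},t)$ denotes the expected value of $\mathfrak{s}(\gamma_1\cdots\gamma_t)$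 where $\gamma_1,\ldots,\gamma_t$ are chosen independently from the uniform distribution on $\Gamma$ (for $t=0$ the empty product is the identity). *)

(* Defs.v *)
From HB Require Import structures.
From mathcomp Require Import all_boot all_order all_fingroup all_algebra.
From mathcomp Require Import complex reals.

Set Implicit Arguments.
Unset Strict Implicit.
Unset Printing Implicit Defensive.

Import Order.TTheory GRing.Theory Num.Theory.

Local Open Scope ring_scope.
Local Open Scope complex_scope.

Definition is_intpart (n : nat) (la : seq nat) : bool :=
  [&& sorted geq la, 0%N \notin la & sumn la == n].

Record intpart (n : nat) := IntPart {
  parts :> seq nat;
  _ : is_intpart n parts
}.

HB.instance Definition _ n := [isSub for @parts n].
HB.instance Definition _ n := [Countable of intpart n by <:].

(* A partition of n has at most n parts, each at most n; this makes intpart n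
   a finite type, so that one can sum over it. *)
Definition intpart_code n (la : intpart n) : n.-bseq 'I_n.+1 :=
  insub_bseq n [seq inord i | i <- la].

Definition intpart_decode n (b : n.-bseq 'I_n.+1) : option (intpart n) :=
  insub [seq val i | i <- b].

Lemma intpart_codeK n : pcancel (@intpart_code n) (@intpart_decode n).
Proof.
move=> la; rewrite /intpart_decode /intpart_code.
have /and3P[_ la0 /eqP sla] := valP la.
have size_la : (size la <= n)%N.
  rewrite -[X in (_ <= X)%N]sla -sum1_size sumnE big_seq [X in (_ <= X)%N]big_seq.
  by apply: leq_sum => i ila; rewrite lt0n; apply: contraNneq la0 => <-.
rewrite val_insubd size_map size_la -map_comp.
have -> : map (val \o @inord n) la = la :> seq nat.
  rewrite -[RHS]map_id; apply/eq_in_map => i ila /=.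
  by rewrite inordK // ltnS -[X in (_ <= X)%N]sla sumnE (big_rem i ila) leq_addr.
exact: valK.
Qed.

HB.instance Definition _ n :=
  isFinite.Build (intpart n) (pcan_enumP (@intpart_codeK n)).

(* The porbits of a permutation are its cycles, fixed points included. *)
Definition cycle_type (n : nat) (p : 'S_n) : seq nat :=
  sort geq [seq #|X| | X : {set 'I_n} in porbits p].

Definition cycle_class (n : nat) (la : intpart n) : {set 'S_n} :=
  [set p | cycle_type p == la].

Definition is_class_function (n : nat) (T : Type) (f : 'S_n -> T) : Prop :=
  forall p q : 'S_n, f (p ^ q)%g = f p.

Definition inner_product (R : realType) (n : nat) (f g : intpart n -> R[i]) :
    R[i] :=
  (n`!%:R)^-1 * \sum_(la : intpart n) #|cycle_class la|%:R * f la * (g la)^*.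

Definition mean_stat (R : realType) (n : nat) (s : 'S_n -> R) (la : intpart n) :
    R[i] :=
  ((#|cycle_class la|%:R)^-1 * \sum_(p in cycle_class la) s p)%:C.

(* Products in 'S_n compose from left to right.  Since reversing a tuple
   permutes Gamma^t, composing from right to left would give the same function,
   and likewise the same expected_stat below. *)
Definition num_factorizations (n : nat) (Gamma : {set 'S_n}) (t : nat)
    (p : 'S_n) : int :=
  #|[set g : t.-tuple 'S_n |
      all (fun x => x \in Gamma) g && ((\prod_(x <- g) x)%g == p)]|%:Z.

Definition expectation (R : realType) (T : finType) (P : T -> R) (X : T -> R) :
    R :=
  \sum_(w : T) P w * X w.

Definition uniform_law (R : realType) (T : finType) (A : {set T}) (x : T) : R :=
  if x \in A then (#|A|%:R)^-1 else 0.

(* The joint law of t independent variables, each of law P. *)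
Definition iid_law (R : realType) (T : finType) (P : T -> R) (t : nat)
    (w : t.-tuple T) : R :=
  \prod_(x <- w) P x.

Definition expected_stat (R : realType) (n : nat) (Gamma : {set 'S_n})
    (s : 'S_n -> R) (t : nat) : R :=
  expectation (@iid_law R _ (uniform_law R Gamma) t)
    (fun g : t.-tuple 'S_n => s (\prod_(x <- g) x)%g).

(* Main.v *)
(* Grouping the tuples by their product turns the expectation into
   |Gamma|^-t * \sum_p s p * n_t p.  Splitting this sum over the cycle classes,
   where one of the two factors is constant, each class contributes its
   cardinality times the product of the two means.  The constancy uses that
   permutations of the same cycle type are conjugate. *)
Require Import Defs.
From mathcomp Require Import all_boot all_order all_fingroup all_algebra.
From mathcomp Require Import complex reals.

Local Open Scope ring_scope.
Local Open Scope complex_scope.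

Set Implicit Arguments.
Unset Strict Implicit.
Unset Printing Implicit Defensive.

Import Order.TTheory GRing.Theory Num.Theory.

(** A permutation of indices turns one list of images into the other; [g] sends an entry of [s1] to
    the entry of [s2] at the matching index. This will pair cycles of equal length. *)
Lemma perm_map_matching (T U : eqType) (f : T -> U) (s1 s2 : seq T) :
    uniq s1 -> uniq s2 -> perm_eq (map f s1) (map f s2) ->
  exists g : T -> T, [/\ {in s1, forall x, g x \in s2},
    {in s1, forall x, f (g x) = f x} & {in s1 &, injective g}].
Proof.
case: s1 => [|x0 s1]; first by exists id; split.
move: (x0 :: s1) => {}s1 u1 u2 fs12.
have /(perm_iotaP (f x0))[Is Is_iota fs1E] := fs12.
rewrite size_map in Is_iota.
have sz12 : size s1 = size s2 by have /perm_size := fs12; rewrite !size_map.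
have szI : size Is = size s2 by rewrite (perm_size Is_iota) size_iota.
have ltI x : x \in s1 -> (nth 0 Is (index x s1) < size s2)%N.
  move=> xs1; have : nth 0%N Is (index x s1) \in Is.
    by rewrite mem_nth // szI -sz12 index_mem.
  by rewrite (perm_mem Is_iota) mem_iota.
exists (fun x => nth x0 s2 (nth 0%N Is (index x s1))); split.
- by move=> x /ltI; exact: mem_nth.
- move=> x xs1; have ltx := ltI _ xs1.
  rewrite -(nth_map x0 (f x0)) // -(nth_map 0%N (f x0) (nth (f x0) _)).
    by rewrite -fs1E (nth_map x0) ?index_mem // nth_index.
  by rewrite szI -sz12 index_mem.
move=> x y xs1 ys1 /eqP; rewrite nth_uniq ?ltI // nth_uniq ?szI -?sz12 ?index_mem //.
  by move=> /eqP /index_inj ->.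
by rewrite (perm_uniq Is_iota) iota_uniq.
Qed.

Lemma iter_porbit_mod (T : finType) (p : {perm T}) (x : T) (k : nat) :
  iter (k %% #|porbit p x|) p x = iter k p x.
Proof.
rewrite [in RHS](divn_eq k #|porbit p x|) addnC iterD; congr iter.
by elim: (k %/ _)%N => // m IHm; rewrite mulSn iterD -IHm iter_porbit.
Qed.

(** Reduced modulo the cycle length, the exponents index a single turn around the cycle, whose
    points are distinct. *)
Lemma iter_porbit_inj (T : finType) (p : {perm T}) (x : T) (j k : nat) :
  iter j p x = iter k p x -> j = k %[mod #|porbit p x|].
Proof.
set m := #|_|; have m_gt0 : (0 < m)%N by rewrite lt0n card_porbit_neq0.
rewrite -iter_porbit_mod -[RHS]iter_porbit_mod -/m => jk; apply/eqP.
rewrite -(nth_uniq x _ _ (uniq_traject_porbit p x)) ?size_traject ?ltn_pmod //.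
by rewrite !nth_traject ?ltn_pmod // jk.
Qed.

Lemma porbit_iter (T : finType) (p : {perm T}) (x : T) (k : nat) :
  porbit p (iter k p x) = porbit p x.
Proof. by rewrite -permX porbit_perm. Qed.

(* Match the cycles of p with those of q, pick a base point on each, and send
   the k-th iterate of the base point under p to the k-th one under q. *)
Lemma perm_porbits_conjg (T : finType) (p q : {perm T}) :
    perm_eq [seq #|X| | X : {set T} in porbits p]
            [seq #|X| | X : {set T} in porbits q] ->
  exists r : {perm T}, q = (p ^ r)%g.
Proof.
case/(perm_map_matching (enum_uniq _) (enum_uniq _)) => g [].
have po (u : {perm T}) x : porbit u x \in enum (porbits u) by rewrite mem_enum imset_f.
move=> g_in g_card g_inj.
(* The default [x] makes [base] total; by [baseE] it has no effect on a nonempty set. *)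
pose base x (X : {set T}) := odflt x [pick y in X].
have baseE x y X : X != set0 -> base x X = base y X.
  case/set0Pn=> z zX; rewrite /base; case: pickP => // /(_ z).
  by rewrite zX.
have base_in x X : X != set0 -> base x X \in X.
  case/set0Pn=> z zX; rewrite /base; case: pickP => // /(_ z).
  by rewrite zX.
have porbit_n0 (u : {perm T}) x : porbit u x != set0.
  by apply/set0Pn; exists x; exact: porbit_id.
(* The base points of the cycle of [x] and of the matched cycle of [q]. *)
pose a x := base x (porbit p x); pose b x := base x (g (porbit p x)).
have gE x : exists y, g (porbit p x) = porbit q y.
  have := g_in _ (po p x); rewrite mem_enum => /imsetP[y _ ->].
  by exists y.
have g_n0 x : g (porbit p x) != set0 by have [y ->] := gE x.
have porbit_a x : porbit p (a x) = porbit p x.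
  by apply/eqP; rewrite eq_porbit_mem base_in.
have porbit_b x : porbit q (b x) = g (porbit p x).
  have := base_in x _ (g_n0 x); have [y gxE] := gE x.
  by rewrite -/(b x) gxE -eq_porbit_mem => /eqP.
have card_b x : #|porbit q (b x)| = #|porbit p (a x)|.
  by rewrite porbit_b g_card // porbit_a.
have ab_eq x y : porbit p x = porbit p y -> a x = a y /\ b x = b y.
  by rewrite /a /b => ->; split; apply: baseE.
have aP x : exists k, x == iter k p (a x).
  have : x \in porbit p (a x) by rewrite porbit_a porbit_id.
  by case/porbitP=> k xE; exists k; rewrite -permX -xE eqxx.
pose e x := ex_minn (aP x).
have eP x : iter (e x) p (a x) = x by rewrite /e; case: ex_minnP => m /eqP.
pose f x := iter (e x) q (b x).
(* Equal images lie on one cycle of [q], so [x] and [y] share a cycle of [p] by injectivity of [g];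
   their exponents then agree modulo the common length of the matched cycles. *)
have f_inj : injective f.
  move=> x y fxy; have : porbit q (f x) = porbit q (f y) by rewrite fxy.
  rewrite !porbit_iter !porbit_b => /(g_inj _ _ (po _ _) (po _ _)) xy.
  have [axy bxy] := ab_eq _ _ xy.
  move: fxy; rewrite /f bxy => /iter_porbit_inj; rewrite card_b => exy.
  by rewrite -(eP x) axy -iter_porbit_mod exy iter_porbit_mod eP.
(* The exponent [e] restarts at the base point, so [e (p x)] and [(e x).+1] agree only modulo the
   cycle length; this suffices because the matched cycle of [q] has the same length. *)
have fp x : f (p x) = q (f x).
  have [ax bx] := ab_eq _ _ (porbit_iter p x 1).
  have : iter (e (p x)) p (a x) = iter (e x).+1 p (a x) by rewrite iterS eP -ax /= eP.
  rewrite /f bx -iterS => /iter_porbit_inj; rewrite -card_b => epx.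
  by rewrite -iter_porbit_mod epx iter_porbit_mod.
(* Since [f] intertwines [p] and [q], the conjugate of [p] by [f] agrees with [q] at every [f x],
   hence everywhere. *)
exists (perm f_inj); apply/permP=> y.
by rewrite -[y](permKV (perm f_inj)) permJ !permE fp.
Qed.

Lemma cycle_type_conjg (n : nat) (p q : 'S_n) :
  cycle_type p = cycle_type q -> exists r : 'S_n, q = (p ^ r)%g.
Proof.
move=> pq; apply: perm_porbits_conjg; apply/(@perm_sortP _ geq).
- by move=> x y; exact: leq_total.
- by move=> x y z xy yx; exact: leq_trans yx xy.
- by move=> x y; rewrite andbC => /anti_leq.
exact: pq.
Qed.

Lemma sum_card_porbits (T : finType) (p : {perm T}) :
  (\sum_(X in porbits p) #|X|)%N = #|T|.
Proof.
have dis : trivIset (porbits p).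
  apply/trivIsetP=> _ _ /imsetP[x _ ->] /imsetP[y _ ->]; apply: contraR.
  case/pred0Pn=> z /andP[/=]; rewrite -!eq_porbit_mem => /eqP <- /eqP <-.
  exact: eqxx.
rewrite (eqP dis) -cardsT; apply: eq_card => x; rewrite inE.
by apply/bigcupP; exists (porbit p x); rewrite ?imset_f ?porbit_id.
Qed.

Lemma cycle_type_intpart (n : nat) (p : 'S_n) : is_intpart n (cycle_type p).
Proof.
apply/and3P; split.
- by apply: sort_sorted => x y; exact: leq_total.
- rewrite mem_sort; apply/mapP=> -[X]; rewrite mem_enum => /imsetP[x _ ->].
  by apply/eqP; rewrite eq_sym card_porbit_neq0.
rewrite sumnE (perm_big _ (permEl (perm_sort _ _))) big_map big_enum /=.
by rewrite sum_card_porbits card_ord.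
Qed.

Lemma class_function_cycle_class (n : nat) (T : Type) (f : 'S_n -> T)
    (la : intpart n) (p q : 'S_n) :
    is_class_function f -> p \in cycle_class la -> q \in cycle_class la ->
  f q = f p.
Proof.
move=> f_cls; rewrite !inE => /eqP pla /eqP qla.
by have [r ->] := cycle_type_conjg (etrans pla (esym qla)).
Qed.

(** Each permutation lies in exactly one class, the one indexed by its cycle type. *)
Lemma sum_cycle_class (V : nmodType) (n : nat) (F : 'S_n -> V) :
  \sum_(la : intpart n) \sum_(p in cycle_class la) F p = \sum_p F p.
Proof.
pose ct (p : 'S_n) := IntPart (cycle_type_intpart p).
rewrite [RHS](partition_big ct xpredT) //=; apply: eq_bigr => la _.
by apply: eq_bigl => p; rewrite inE.
Qed.

(** The mean of the constant factor is its value, and [#|A|] cancels the denominator of the other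
    mean. *)
Lemma sum_mul_mean (F : numFieldType) (T : finType) (A : {set T})
    (f g : T -> F) :
    {in A &, forall x y, f x = f y} \/ {in A &, forall x y, g x = g y} ->
  #|A|%:R * (#|A|%:R^-1 * \sum_(x in A) f x) *
    (#|A|%:R^-1 * \sum_(x in A) g x) = \sum_(x in A) f x * g x.
Proof.
wlog fA : f g / {in A &, forall x y, f x = f y} => [hw|_].
  case=> [fA|gA]; first by apply: hw => //; left.
  under [RHS]eq_bigr do rewrite mulrC.
  by rewrite mulrAC hw //; left.
(* Treating the empty set here spares a proof that every partition is a cycle type. *)
have [->|[a aA]] := set_0Vmem A; first by rewrite !big_set0 !mulr0.
have A_neq0 : #|A|%:R != 0 :> F by rewrite pnatr_eq0 -lt0n (cardD1 a) aA.
rewrite mulVKf // (eq_bigr (fun=> f a)) => [|x xA]; last exact: fA.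
rewrite sumr_const -[f a *+ _]mulr_natr -mulrA mulVKf // mulr_sumr.
by apply: eq_bigr => x xA; rewrite (fA x a).
Qed.

Lemma iid_law_uniform (R : realType) (T : finType) (A : {set T}) (t : nat)
    (w : t.-tuple T) :
  iid_law (uniform_law R A) w =
  if all (fun x => x \in A) w then #|A|%:R ^- t else 0.
Proof.
rewrite /iid_law -exprVn; case: w => l /= /eqP <-.
elim: l => [|x l IHl]; first by rewrite big_nil.
rewrite big_cons IHl /uniform_law /=; case: ifP => _ /=; last by rewrite mul0r.
by case: ifP => _; rewrite ?mulr0 ?exprS.
Qed.

Lemma expected_statE (R : realType) (n : nat) (Gamma : {set 'S_n})
    (s : 'S_n -> R) (t : nat) :
  expected_stat Gamma s t =
  #|Gamma|%:R ^- t * \sum_p s p * (num_factorizations Gamma t p)%:~R.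
Proof.
rewrite /expected_stat /expectation.
rewrite (partition_big (fun g : t.-tuple 'S_n => (\prod_(x <- g) x)%g) xpredT) //.
rewrite mulr_sumr; apply: eq_bigr => p _ /=.
rewrite /num_factorizations -pmulrn -sum1_card natr_sum !mulr_sumr.
(* With membership in [Gamma] moved into the summand, both sums run over the tuples with product
   [p]. *)
rewrite [RHS](eq_bigl _ _ (fun g => in_set _ g)) [RHS]big_mkcondl /=.
apply: eq_bigr => g /eqP ->; rewrite iid_law_uniform mulr1.
by case: ifP => _; rewrite ?mul0r.
Qed.

Theorem theorem3p1 (R : realType) (n : nat) (n_ge1 : (1 <= n)%N)
    (Gamma : {set 'S_n}) (Gamma_neq0 : Gamma != set0)
    (s : 'S_n -> R) (t : nat) :
  is_class_function (num_factorizations Gamma t) \/ is_class_function s ->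
  (expected_stat Gamma s t)%:C =
    n`!%:R / #|Gamma|%:R ^+ t *
    inner_product (mean_stat s)
      (mean_stat (fun p : 'S_n => (num_factorizations Gamma t p)%:~R : R)).
Proof.
move=> cls.
have n_neq0 : n`!%:R != 0 :> R[i] by rewrite pnatr_eq0 -lt0n fact_gt0.
rewrite expected_statE -sum_cycle_class /inner_product.
(* The factor [n!] cancels the normalisation of the inner product. *)
rewrite [_ / _]mulrC -[RHS]mulrA mulVKf // rmorphM fmorphV /=.
rewrite rmorphXn rmorph_nat rmorph_sum; congr (_ * _).
apply: eq_bigr => la _; rewrite -sum_mul_mean; last first.
  case: cls => [N_cls|s_cls]; [right | left] => p q pla qla.
    by rewrite (class_function_cycle_class N_cls qla pla).
  exact: class_function_cycle_class s_cls qla pla.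
(* The means are real, so conjugation fixes them. *)
rewrite 2!rmorphM rmorph_nat; congr (_ * _); apply/esym; exact: conjc_real.
Qed.
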